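(* Let $S=T\circ T\circ T$ be the third iterate of the Collatz map $T:\mathbb{N}\to\mathbb{N}$. For every integer $m\ge 1$ and all $j=0,\dots,8^m-1$, $$\mu_{inv}\left[S^{-1}\mathcal{B}(j,8^m)\right]=\mu_{inv}\left[\mathcal{B}(j,8^m)\right].$$
   Context: $\mathbb{N}$ denotes the positive integers. The Collatz map $T:\mathbb{N}\to\mathbb{N}$ is $T(n)=n/2$ if $n$ is even and $T(n)=3n+1$ if $n$ is odd. For $m\ge1$ and $i\in\{0,\dots,8^m-1\}$, $\mathcal{B}(i,8^m)=\{n\in\mathbb{N}:\exists k\in\mathbb{N}\cup\{0\},\ n=i+8^mk\}$. $S^{-1}A$ denotes the preimage $\{n\in\mathbb{N}:S(n)\in A\}$. $\mu_{inv}$ is the finitely additive set function, defined on finite unions of classes $\mathcal{B}(i,8^m)$ ($m\ge 1$, $0\le i\le 8^m-1$), determined by $$\mu_{inv}(\mathcal{B}(i,8^m))=\frac{\nu(i)}{8^{m-1}},\qquad \nu(i)=\tfrac16 \text{ if } i \text{ is even},\quad \nu(i)=\tfrac1{12}\text{ if } i\text{ is odd}.$$ The set $S^{-1}\mathcal{B}(j,8^m)$ is a finite union of classes modulo $8^{m+1}$, so its $\mu_{inv}$-value is defined. *)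

(* Defs.v *)
From HB Require Import structures.
From mathcomp Require Import all_boot all_order all_algebra.
From mathcomp Require Import all_classical all_reals all_analysis.

Set Implicit Arguments.
Unset Strict Implicit.
Unset Printing Implicit Defensive.

Import Order.TTheory GRing.Theory Num.Theory.
Local Open Scope classical_set_scope.
Local Open Scope ring_scope.

Record posnat := PosNat { posnat_val :> nat; posnat_gt0 : (0 < posnat_val)%N }.

HB.instance Definition _ := [isSub for posnat_val].
HB.instance Definition _ := [Choice of posnat by <:].
HB.instance Definition _ := isPointed.Build posnat (@PosNat 1 isT).

Definition collatz_nat (n : nat) : nat :=
  if odd n then (3 * n + 1)%N else (n %/ 2)%N.

Lemma collatz_nat_gt0 (n : posnat) : (0 < collatz_nat n)%N.
Proof.
rewrite /collatz_nat; case: ifP => [_|no]; first by rewrite addn1.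
by case: n no => -[|[|n]] //= _ _; rewrite divn_gt0.
Qed.

Definition collatz (n : posnat) : posnat := PosNat (collatz_nat_gt0 n).

Definition collatz3 : posnat -> posnat := collatz \o collatz \o collatz.

Definition residue_class (i q : nat) : set posnat :=
  [set n | exists k : nat, n = (i + q * k)%N :> nat].

(* Finite unions of classes modulo powers of 8; the moduli may differ within
   one union. *)
Definition finite_class_union (A : set posnat) : Prop :=
  exists2 s : seq (nat * nat),
    (forall p, p \in s -> (1 <= p.2)%N /\ (p.1 < 8 ^ p.2)%N) &
    A = \bigcup_(p in [set` s]) residue_class p.1 (8 ^ p.2).

Definition periodic8 (m : nat) (A : set posnat) : Prop :=
  forall x y : posnat, x = y %[mod 8 ^ m] -> A x -> A y.

Lemma rep8_subproof m i : (0 < i + 8 ^ m)%N.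
Proof. by rewrite addn_gt0 expn_gt0 orbT. Qed.

Definition rep8 m i : posnat := PosNat (rep8_subproof m i).

Lemma rep8_mod m i (x : posnat) : x = i %[mod 8 ^ m] ->
  x = rep8 m i %[mod 8 ^ m].
Proof. by move=> xi; rewrite /= modnDr. Qed.

Lemma residue_classE m i (x : posnat) : (i < 8 ^ m)%N ->
  residue_class i (8 ^ m) x <-> (x %% 8 ^ m)%N = i.
Proof.
move=> im; split=> [[k ->]|xi].
  by rewrite addnC mulnC modnMDl modn_small.
by exists (x %/ 8 ^ m)%N; rewrite {1}(divn_eq x (8 ^ m)) xi addnC mulnC.
Qed.

Lemma periodic8_class m i : (i < 8 ^ m)%N ->
  periodic8 m (residue_class i (8 ^ m)).
Proof.
move=> im x y xy /residue_classE -/(_ im) xi.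
by apply/residue_classE; rewrite // -xy.
Qed.

Lemma periodic8W m n A : (m <= n)%N -> periodic8 m A -> periodic8 n A.
Proof.
move=> mn pA x y xy; apply: pA.
by rewrite -(modn_dvdm x (dvdn_exp2l 8 mn)) xy modn_dvdm // dvdn_exp2l.
Qed.

Lemma periodic8_setC m A : periodic8 m A -> periodic8 m (~` A).
Proof. by move=> pA x y xy nAx Ay; apply: nAx; apply: pA Ay. Qed.

Lemma periodic8_setU m A B :
  periodic8 m A -> periodic8 m B -> periodic8 m (A `|` B).
Proof.
by move=> pA pB x y xy [/(pA _ _ xy)|/(pB _ _ xy)]; [left|right].
Qed.

Lemma finite_class_unionP A : finite_class_union A <->
  exists2 m, (1 <= m)%N & periodic8 m A.
Proof.
split=> [[s]|[m m1 pA]].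
  elim: s A => [|p s IHs] A hs ->.
    by exists 1%N => // x y _ [].
  have [|m m1 pm] := IHs _ _ erefl; first by move=> q qs; apply: hs; rewrite inE qs orbT.
  have [p1 p2] := hs p (mem_head _ _).
  exists (maxn m p.2); first by rewrite leq_max m1.
  have -> : \bigcup_(q in [set` p :: s]) residue_class q.1 (8 ^ q.2) =
     residue_class p.1 (8 ^ p.2) `|`
     \bigcup_(q in [set` s]) residue_class q.1 (8 ^ q.2).
    apply/seteqP; split=> [x [q /=]|x [px|[q /= qs qx]]].
    - by rewrite inE => /orP[/eqP ->|qs] qx; [left|right; exists q].
    - by exists p => //=; rewrite mem_head.
    - by exists q => //=; rewrite inE qs orbT.
  apply: periodic8_setU.
    by apply: periodic8W (periodic8_class p2); rewrite leq_maxr.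
  by apply: periodic8W pm; rewrite leq_maxl.
exists [seq (i, m) | i <- iota 0 (8 ^ m) & `[< A (rep8 m i) >] ].
  move=> p /mapP[i]; rewrite mem_filter mem_iota => /andP[_ /andP[_ im]] -> /=.
  by split.
apply/seteqP; split=> [x Ax|x [p /= /mapP[i]]].
  have xm : (x %% 8 ^ m < 8 ^ m)%N by rewrite ltn_mod expn_gt0.
  exists ((x %% 8 ^ m)%N, m) => /=; last exact/residue_classE.
  apply/mapP; exists (x %% 8 ^ m)%N => //.
  rewrite mem_filter mem_iota /= add0n xm andbT; apply/asboolP.
  by apply: pA Ax; apply: rep8_mod; rewrite modn_mod.
rewrite mem_filter mem_iota /= add0n => /andP[/asboolP Ai im] -> /=.
move=> /residue_classE -/(_ im) xi; apply: pA Ai.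
by rewrite /= modnDr modn_small.
Qed.

Lemma finite_class_union0 : finite_class_union set0.
Proof. by exists [::] => //; apply/seteqP; split=> x // []. Qed.

Lemma finite_class_unionU : setU_closed finite_class_union.
Proof.
move=> A B /finite_class_unionP[m m1 pA] /finite_class_unionP[n n1 pB].
apply/finite_class_unionP; exists (maxn m n); first by rewrite leq_max m1.
apply: periodic8_setU; [apply: periodic8W pA|apply: periodic8W pB].
  by rewrite leq_maxl.
by rewrite leq_maxr.
Qed.

Lemma finite_class_unionC : setC_closed finite_class_union.
Proof.
move=> A /finite_class_unionP[m m1 pA].
by apply/finite_class_unionP; exists m => //; exact: periodic8_setC.
Qed.

(* From here on, [measurable] on [posnat] means [finite_class_union], so
   [{additive_charge set posnat -> \bar R}] is the type of finitely additive,
   finite-valued set functions on this algebra (values outside the algebra are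
   unconstrained). *)
HB.instance Definition _ := isAlgebraOfSets.Build default_measure_display
  posnat finite_class_union0 finite_class_unionU finite_class_unionC.

Section mu_inv.
Context (R : realType).

Definition nu (i : nat) : R := if odd i then 12^-1 else 6^-1.

Definition is_mu_inv (mu : {additive_charge set posnat -> \bar R}) : Prop :=
  forall m i : nat, (1 <= m)%N -> (i < 8 ^ m)%N ->
    mu (residue_class i (8 ^ m)) = (nu i / 8 ^+ m.-1)%:E.

Definition weight8 (m : nat) (A : set posnat) : R :=
  \sum_(0 <= i < 8 ^ m) (if `[< A (rep8 m i) >] then nu i / 8 ^+ m.-1 else 0).

Lemma is_mu_inv_weight8 mu m A : is_mu_inv mu -> (1 <= m)%N -> periodic8 m A ->
  mu A = (weight8 m A)%:E.
Proof.
move=> hmu m1 pA.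
pose F i := if `[< A (rep8 m i) >] && (i < 8 ^ m)%N
  then residue_class i (8 ^ m) else set0.
have FP i x : F i x <-> [/\ A x, (i < 8 ^ m)%N & (x %% 8 ^ m)%N = i].
  rewrite /F; case: ifPn => [/andP[/asboolP Ai im]|nA]; last first.
    split=> // -[Ax im xi]; move: nA; rewrite im andbT => /asboolP; apply.
    by apply: pA Ax; apply: rep8_mod; rewrite -xi modn_mod.
  rewrite (residue_classE _ im); split=> [xi|[]//]; split=> //.
  by apply: pA Ai; rewrite /= modnDr xi modn_small.
have AE : A = \big[setU/set0]_(i < 8 ^ m) F i.
  rewrite -bigcup_mkord; apply/seteqP; split=> [x Ax|x [i _ /FP[]//]].
  have xm : (x %% 8 ^ m < 8 ^ m)%N by rewrite ltn_mod expn_gt0.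
  by exists (x %% 8 ^ m)%N => //; apply/FP.
have mF i : measurable (F i).
  rewrite /F; case: ifPn => [/andP[_ im]|_]; last exact: measurable0.
  by apply/finite_class_unionP; exists m => //; exact: periodic8_class.
rewrite {1}AE charge_semi_additive //; last first.
- by rewrite -AE; apply/finite_class_unionP; exists m.
- by move=> i j _ _ [x [/FP[_ _ <-] /FP[_ _ <-]]].
rewrite /weight8 big_mkord -sumEFin; apply: eq_bigr => i _.
rewrite /F ltn_ord andbT; case: ifP => _; first exact: hmu.
have := @charge_semi_additive _ _ _ mu (fun=> set0) 0%N.
by rewrite !big_ord0; apply => //; exact: trivIset_set0.
Qed.

(* The prescribed values determine the set function on the whole algebra. *)
Lemma is_mu_inv_unique mu1 mu2 (A : set posnat) :
  is_mu_inv mu1 -> is_mu_inv mu2 -> finite_class_union A -> mu1 A = mu2 A.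
Proof.
move=> h1 h2 /finite_class_unionP[m m1 pA].
by rewrite (is_mu_inv_weight8 h1 m1 pA) (is_mu_inv_weight8 h2 m1 pA).
Qed.

Lemma weight8S m A : (1 <= m)%N -> periodic8 m A ->
  weight8 m.+1 A = weight8 m A.
Proof.
case: m => // m _ pA; rewrite /weight8 [in LHS]expnS big_nat_mul.
transitivity (\sum_(0 <= i < 8) (8^-1 * \sum_(0 <= j < 8 ^ m.+1)
  (if `[< A (rep8 m.+1 j) >] then nu j / 8 ^+ m else 0))); last first.
  by rewrite sumr_const_nat subn0 -[LHS]mulr_natl mulrA divff ?mul1r ?pnatr_eq0.
apply: eq_bigr => i _; rewrite -{1}[(i * _)%N]add0n big_addn mulSn addnK.
rewrite big_distrr; apply: eq_bigr => j _ /=.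
have -> : `[< A (rep8 m.+2 (j + i * 8 ^ m.+1)) >] = `[< A (rep8 m.+1 j) >].
  have e : (j + i * 8 ^ m.+1 + 8 ^ m.+2 = (i + 8) * 8 ^ m.+1 + j)%N.
    by rewrite (expnS 8 m.+1) -addnA -mulnDl addnC.
  by apply: asbool_equiv_eq; split; apply: pA; rewrite /= e modnMDl modnDr.
case: ifP => _; last by rewrite mulr0.
rewrite /nu oddD oddM oddX andbF addbF exprS invfM.
by rewrite mulrCA.
Qed.

Lemma weight8W m n A : (1 <= m)%N -> (m <= n)%N -> periodic8 m A ->
  weight8 n A = weight8 m A.
Proof.
move=> m1 /subnK <- pA; elim: (n - m)%N => // k IHk.
rewrite addSn weight8S ?IHk // ?(leq_trans m1) ?leq_addl //.
by apply: periodic8W pA; rewrite leq_addl.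
Qed.

(* Witness for [is_mu_inv_exists] only. *)
Definition mu_weight (A : set posnat) : \bar R :=
  if pselect (exists m, (1 <= m)%N /\ periodic8 m A) is left h
  then (weight8 (projT1 (cid h)) A)%:E else 0%E.

Lemma mu_weightE m A : (1 <= m)%N -> periodic8 m A ->
  mu_weight A = (weight8 m A)%:E.
Proof.
move=> m1 pA; rewrite /mu_weight; case: pselect => [h|[]]; last by exists m.
case: cid => n [n1 pnA] /=; congr EFin.
by case: (leqP m n) => [mn|/ltnW nm]; [|symmetry]; exact: weight8W.
Qed.

Lemma mu_weight_fin : fin_num_fun mu_weight.
Proof. by move=> A /finite_class_unionP[m m1 pA]; rewrite (mu_weightE m1 pA). Qed.

Lemma mu_weight_semi_additive : measure_function.semi_additive mu_weight.
Proof.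
have w0 : mu_weight set0 = 0%E.
  rewrite (@mu_weightE 1%N) // /weight8 big1 // => i _.
  by rewrite asboolF.
apply/additive2P => // A B /finite_class_unionP[m m1 pA].
move=> /finite_class_unionP[n n1 pB] AB.
pose k := maxn m n.
have k1 : (1 <= k)%N by rewrite leq_max m1.
have {}pA : periodic8 k A by apply: periodic8W pA; rewrite leq_maxl.
have {}pB : periodic8 k B by apply: periodic8W pB; rewrite leq_maxr.
rewrite (mu_weightE k1 (periodic8_setU pA pB)).
rewrite (mu_weightE k1 pA) (mu_weightE k1 pB) -EFinD -big_split; congr EFin.
apply: eq_bigr => i _ /=; rewrite asbool_or.
case: asboolP => Ai; case: asboolP => Bi /=; rewrite ?addr0 ?add0r //.
have : (A `&` B) (rep8 k i) by [].
by rewrite AB.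
Qed.

HB.instance Definition _ := isFinite.Build _ _ _ mu_weight mu_weight_fin.
HB.instance Definition _ :=
  isAdditiveCharge.Build _ _ _ mu_weight mu_weight_semi_additive.

Lemma is_mu_inv_exists :
  exists mu : {additive_charge set posnat -> \bar R}, is_mu_inv mu.
Proof.
exists mu_weight => m i m1 im /=.
rewrite (mu_weightE m1 (periodic8_class im)) /weight8; congr EFin.
rewrite (bigD1_seq i) /= ?mem_index_iota ?iota_uniq //.
rewrite asboolT; last by apply/residue_classE => //=; rewrite modnDr modn_small.
rewrite big_seq_cond big1 ?addr0 // => j /andP[].
rewrite mem_index_iota => /andP[_ jm] ji.
rewrite asboolF // => /residue_classE -/(_ im) /=.
by rewrite modnDr modn_small // => /eqP; exact/negP.
Qed.

(* The chosen representative is unique on finite class unions, by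
   [is_mu_inv_unique]. *)
Definition mu_inv : {additive_charge set posnat -> \bar R} :=
  projT1 (cid is_mu_inv_exists).

Lemma mu_invP : is_mu_inv mu_inv.
Proof. exact: projT2 (cid is_mu_inv_exists). Qed.

End mu_inv.

(* Main.v *)
Require Import Defs.
From mathcomp Require Import all_boot all_order all_algebra.
From mathcomp Require Import all_classical all_reals all_analysis.
From mathcomp Require Import zify ring.

(** Already a single step [T] of the Collatz map preserves the set function, so
the claim follows by applying this three times.

Let [lambda] be the natural density on periodic sets. The prescribed values say
that the set function has density 4/3 with respect to [lambda] on the even
integers and 2/3 on the odd ones. For a periodic set [A], the preimage under
[T] splits by parity into [2A] and the set of odd [n] with [3n + 1] in [A].
- [2A] consists of even integers and has density [lambda A / 2], so it weighs
  [2/3 * lambda A].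
- [3n + 1] is even when [n] is odd, so the second set only sees the even part
  [E] of [A]. Multiplication by 3 is invertible modulo powers of 2, hence
  [n |-> 3n + 1] maps the odd classes onto the even classes bijectively modulo
  a power of 2, and this set, made of odd integers, weighs [2/3 * lambda E].
The sum is [4/3 * lambda E + 2/3 * lambda (A \ E)], the weight of [A].

Densities are sums over one period. [sum_modn] allows summing over a multiple
of a period, [sum_parity] separates even from odd indices and
[sum_affine_modn] expresses the bijectivity of affine maps; they
combine in [collatz_weight_sum], and [mu_inv_collatz] is the invariance under
one step. *)

Import Order.TTheory GRing.Theory Num.Theory.
Local Open Scope classical_set_scope.
Local Open Scope ring_scope.

(** * Sums of periodic functions *)

Lemma sum_parity (V : nmodType) (F : nat -> V) (n : nat) :
  \sum_(0 <= i < 2 * n) F i =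
  \sum_(0 <= k < n) F (2 * k)%N + \sum_(0 <= k < n) F (2 * k + 1)%N.
Proof.
elim: n => [|n IHn]; first by rewrite muln0 !big_geq // addr0.
rewrite (_ : (2 * n.+1 = (2 * n).+2)%N); last by lia.
by rewrite !big_nat_recr //= IHn -addrA addrACA addn1.
Qed.

Lemma sum_modn (V : nmodType) (F : nat -> V) (c n : nat) :
  \sum_(0 <= i < c * n) F (i %% n)%N = (\sum_(0 <= i < n) F i) *+ c.
Proof.
rewrite big_nat_mul -[in RHS](subn0 c) -sumr_const_nat.
apply: eq_bigr => k _; rewrite -{1}[(k * n)%N]add0n big_addn mulSn addnK.
apply: eq_big_nat => i /andP[_ i_lt].
by rewrite addnC modnMDl modn_small.
Qed.

Lemma sum_affine_modn (V : nmodType) (F : nat -> V) (c d n : nat) :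
  coprime c n ->
  \sum_(0 <= i < n) F ((c * i + d) %% n)%N = \sum_(0 <= i < n) F i.
Proof.
case: n => [|n] co; first by rewrite !big_geq.
have f_lt (i : 'I_n.+1) : ((c * i + d) %% n.+1 < n.+1)%N by rewrite ltn_mod.
have f_inj : injective (fun i => Ordinal (f_lt i)).
  move=> i k [] /eqP; rewrite eqn_modDr => /eqP eq_ck; apply: val_inj => /=.
  wlog le_ik : i k eq_ck / (i <= k)%N.
    move=> hwlog; case/orP: (leq_total i k) => [|le_ki]; first exact: hwlog.
    by apply/esym/hwlog.
  move/esym/eqP: eq_ck; rewrite eqn_mod_dvd ?leq_mul2l ?le_ik ?orbT //.
  rewrite -mulnBr Gauss_dvdr 1?coprime_sym // -eqn_mod_dvd //.
  by rewrite !modn_small // => /eqP.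
by rewrite !big_mkord [RHS](reindex_inj f_inj).
Qed.

(** * Invariance under one Collatz step *)

(** For the indicator [a] of a set of period [2 * h], this compares the weight
of the preimage with that of the set. The even indices on the left reach every
class, the odd ones reach each even class, and adding the two contributions
restores the ratio 2 : 1 between even and odd classes. The preimage already has
period [4 * h]; summing over 8 periods matches moduli that are powers of 8. *)
Lemma collatz_weight_sum (R : realType) (a : nat -> R) (h : nat) :
  coprime 3 h ->
  (forall i, a (i %% (2 * h))%N = a i) ->
  \sum_(0 <= i < 8 * (2 * h)) nu R i * a (collatz_nat i) =
  8%:R * \sum_(0 <= i < 2 * h) nu R i * a i.
Proof.
move=> co a_per; rewrite (_ : (8 * (2 * h) = 2 * (4 * (2 * h)))%N); last by lia.
rewrite !sum_parity.
have -> : \sum_(0 <= k < 4 * (2 * h)) nu R (2 * k) * a (collatz_nat (2 * k)) =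
    6^-1 * ((\sum_(0 <= k < h) a (2 * k)%N +
             \sum_(0 <= k < h) a (2 * k + 1)%N) *+ 4).
  rewrite -sum_parity -sum_modn big_distrr /=; apply: eq_bigr => k _.
  by rewrite /nu /collatz_nat oddM /= mulKn // a_per.
have -> : \sum_(0 <= k < 4 * (2 * h))
      nu R (2 * k + 1) * a (collatz_nat (2 * k + 1)) =
    12^-1 * ((\sum_(0 <= k < h) a (2 * k)%N) *+ 8).
  (* Here 3 (2 k + 1) + 1 = 2 (3 k + 2), and [k |-> a (2 k)] has period [h]. *)
  rewrite (_ : (4 * (2 * h) = 8 * h)%N); last by lia.
  rewrite -(sum_affine_modn R (fun k => a (2 * k)%N) 3 2 h co).
  rewrite -sum_modn big_distrr /=; apply: eq_bigr => k _.
  rewrite /nu /collatz_nat oddD oddM /= muln_modr a_per.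
  rewrite -[in RHS]a_per -muln_modr -modnDml modnMmr modnDml muln_modr a_per.
  by congr (_ * a _); lia.
under [in RHS]eq_bigr do rewrite /nu oddM /=.
under [X in _ = _ * (_ + X)]eq_bigr do rewrite /nu oddD oddM /=.
by rewrite -!big_distrr /=; field.
Qed.

(** Period [8 ^ m] becomes [2 * 8 ^ m], since halving loses one binary digit;
the next power of 8 is a multiple of this. *)
Lemma periodic8_collatz (m : nat) (A : set posnat) :
  periodic8 m A -> periodic8 m.+1 (collatz @^-1` A).
Proof.
move=> pA x y xy; apply: pA; rewrite /= /collatz_nat.
have xy2 : x = y %[mod 2 * 8 ^ m].
  have d : (2 * 8 ^ m %| 8 ^ m.+1)%N by rewrite expnS dvdn_mul.
  by rewrite -(modn_dvdm x d) xy modn_dvdm.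
have -> : odd x = odd y.
  have d : (2 %| 2 * 8 ^ m)%N by rewrite dvdn_mulr.
  suff : (odd x : nat) = odd y by case: (odd x) (odd y) => [] [].
  by rewrite -!modn2 -(modn_dvdm x d) xy2 modn_dvdm.
case: ifP => _; last by rewrite !modn_divl [(8 ^ m * 2)%N]mulnC xy2.
have d : (8 ^ m %| 2 * 8 ^ m)%N by rewrite dvdn_mull.
have {xy2}xy1 : x = y %[mod 8 ^ m] by rewrite -(modn_dvdm x d) xy2 modn_dvdm.
by rewrite -modnDml -modnMmr xy1 modnMmr modnDml.
Qed.

Lemma weight8_sum (R : realType) (m : nat) (A : set posnat) :
  weight8 R m A =
  (\sum_(0 <= i < 8 ^ m) nu R i * `[< A (rep8 m i) >]%:R) / 8 ^+ m.-1.
Proof.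
rewrite big_distrl; apply: eq_bigr => i _ /=.
by case: ifP => _; rewrite ?mulr1 // mulr0 mul0r.
Qed.

Lemma weight8_collatz (R : realType) (m : nat) (A : set posnat) :
  (1 <= m)%N -> periodic8 m A ->
  weight8 R m.+1 (collatz @^-1` A) = weight8 R m A.
Proof.
case: m => // m _ pA.
pose a i : R := `[< A (rep8 m.+1 i) >]%:R.
have a_mod i k : i = k %[mod 8 ^ m.+1] -> a i = a k.
  move=> ik; congr (_%:R); congr nat_of_bool.
  by apply: asbool_equiv_eq; split; apply: pA; rewrite /= !modnDr.
have q2 : (8 ^ m.+1 = 2 * (4 * 8 ^ m))%N by rewrite expnS mulnA.
rewrite !weight8_sum /= expnS.
have -> : \sum_(0 <= i < 8 * 8 ^ m.+1)
      nu R i * `[< A (collatz (rep8 m.+2 i)) >]%:R =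
    \sum_(0 <= i < 8 * 8 ^ m.+1) nu R i * a (collatz_nat i).
  apply: eq_bigr => i _; congr (_ * _%:R); congr nat_of_bool.
  (* The representative of [i] is [i + 8 ^ m.+2], whose image under the Collatz
     map is that of [i] plus 4 or 24 periods. *)
  have e : collatz_nat (i + 8 ^ m.+2) = collatz_nat i %[mod 8 ^ m.+1].
    have odd_e : odd (i + 8 ^ m.+2) = odd i by rewrite oddD oddX addbF.
    rewrite /collatz_nat odd_e (expnS 8 m.+1); case: ifP => _.
      by rewrite mulnDr addnAC mulnA addnC modnMDl.
    rewrite (_ : (8 * 8 ^ m.+1 = 4 * 8 ^ m.+1 * 2)%N); last by lia.
    by rewrite addnC divnMDl // modnMDl.
  by apply: asbool_equiv_eq; split; apply: pA; rewrite /= modnDr.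
rewrite q2 collatz_weight_sum -?q2.
- rewrite exprS invfM mulrACA mulrC.
  by rewrite mulfV ?pnatr_eq0 // mulr1.
- by rewrite coprimeMr coprimeXr.
- by move=> i; apply: a_mod; rewrite modn_mod.
Qed.

Lemma mu_inv_collatz (R : realType) (m : nat) (A : set posnat) :
  (1 <= m)%N -> periodic8 m A ->
  mu_inv R (collatz @^-1` A) = mu_inv R A.
Proof.
move=> m1 pA; rewrite (is_mu_inv_weight8 (mu_invP R) m1 pA).
rewrite (is_mu_inv_weight8 (mu_invP R) (ltn0Sn m) (periodic8_collatz _ _ pA)).
by rewrite weight8_collatz.
Qed.

(** * Invariance under the third iterate *)

Theorem theorem5 (R : realType) (m : nat) (hm : (1 <= m)%N)
    (j : nat) (hj : (j < 8 ^ m)%N) :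
  mu_inv R (collatz3 @^-1` residue_class j (8 ^ m)) =
  mu_inv R (residue_class j (8 ^ m)).
Proof.
have p0 := periodic8_class hj.
have p1 := periodic8_collatz _ _ p0.
have p2 := periodic8_collatz _ _ p1.
rewrite -(mu_inv_collatz R _ _ hm p0) -(mu_inv_collatz R _ _ (ltn0Sn m) p1).
by rewrite -(mu_inv_collatz R _ _ (ltn0Sn m.+1) p2).
Qed.
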